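(* Let $G$ be a bipartite simple graph of order $n$ without isolated vertices. Then $I_RE(G)\leq n-2+\sqrt{2}$, and equality holds if and only if $G$ is a complete bipartite graph.
   Context: All graphs are simple and finite. For a graph $G$ with vertex set $V(G)=\{v_1,\dots,v_n\}$, edge set $E(G)=\{e_1,\dots,e_m\}$ and degrees $d_i=\deg(v_i)$, the Randić incidence matrix $I_R(G)$ is the $n\times m$ matrix whose $(i,j)$-entry is $d_i^{-1/2}$ if $v_i$ is incident to $e_j$ and $0$ otherwise. Its singular values $\sigma_1(G),\dots,\sigma_n(G)$ are the square roots of the eigenvalues of the $n\times n$ matrix $I_R(G)I_R(G)^T$, and the Randić incidence energy is $I_RE(G)=\sum_{i=1}^n\sigma_i(G)$. *)

(* Defs.v *)
From mathcomp Require Import all_boot all_order all_algebra.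
From mathcomp Require Import polyrcf complex.
Set Implicit Arguments.
Unset Strict Implicit.
Unset Printing Implicit Defensive.
Import Order.TTheory GRing.Theory Num.Theory.
Local Open Scope ring_scope.

Record sgraph (T : finType) := SGraph {
  adj :> rel T;
  adj_sym : symmetric adj;
  adj_irr : irreflexive adj }.

Definition edges (T : finType) (G : sgraph T) : {set {set T}} :=
  [set [set p.1; p.2] | p : T * T & G p.1 p.2].

Definition deg (T : finType) (G : sgraph T) (x : T) : nat := #|[set y | G x y]|.

Definition no_isolated (T : finType) (G : sgraph T) : Prop :=
  forall x : T, (0 < deg G x)%N.

Definition bipartite (T : finType) (G : sgraph T) : Prop :=
  exists A : {set T}, forall x y : T, G x y -> (x \in A) != (y \in A).

Definition complete_bipartite (T : finType) (G : sgraph T) : Prop :=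
  exists A : {set T}, [/\ A != set0, ~: A != set0 &
    forall x y : T, G x y = ((x \in A) != (y \in A))].

Definition randic_incidence (R : rcfType) (T : finType) (G : sgraph T) :
    'M[R]_(#|T|, #|edges G|) :=
  \matrix_(i, j) (if enum_val i \in (enum_val j : {set T})
                  then (Num.sqrt (deg G (enum_val i))%:R)^-1 else 0).

(* The eigenvalues of A lying in R, each repeated according to its algebraic
   multiplicity.  For a symmetric A there are exactly n of them, see
   char_poly_eigenvalues. *)
Definition eigenvalues (R : rcfType) (n : nat) (A : 'M[R]_n) : seq R :=
  flatten [seq nseq (mup x (char_poly A)) x | x <- rootsR (char_poly A)].

Lemma char_poly_split (R : rcfType) (n : nat) (A : 'M[R]_n) :
  A^T = A -> exists d : 'I_n -> R, char_poly A = \prod_i ('X - (d i)%:P).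
Proof.
move=> sA; pose f := real_complex R.
have Ah : map_mx f A \is symmetricmx.
  by rewrite qualifE /= expr0 scale1r map_mx_id // map_trmx sA.
have Ar : map_mx f A \is a realmx.
  by apply/mxOverP=> i j; rewrite mxE; apply/complex_realP; exists (A i j).
have /hermitian_spectral_diag_real/mxOverP dr := realsym_hermsym Ah Ar.
have /orthomx_spectralP := symmetric_normalmx Ah Ar.
set P := spectralmx _; set D := spectral_diag _ => AE.
have Pu : P \in unitmx by apply: spectral_unit.
exists (fun i => complex.Re (D 0 i)).
apply: (map_poly_inj f); rewrite map_char_poly rmorph_prod /=.
transitivity (char_poly (diag_mx D)).
  pose Q := map_mx polyC P.
  have QV : map_mx polyC (invmx P) *m Q = 1%:M by rewrite -map_mxM mulVmx // map_mx1.
  rewrite [in LHS]AE /char_poly.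
  have -> : char_poly_mx (invmx P *m diag_mx D *m P) =
     map_mx polyC (invmx P) *m char_poly_mx (diag_mx D) *m Q.
    rewrite /char_poly_mx !map_mxM mulmxBr mulmxBl; congr (_ - _).
    by rewrite scalar_mxC -mulmxA QV mulmx1.
  by rewrite !det_mulmx mulrAC -det_mulmx QV det1 mul1r.
rewrite char_poly_trig ?diag_mx_is_trig //; apply: eq_bigr => i _.
rewrite mxE eqxx mulr1n rmorphB /= map_polyX map_polyC /=.
by have /complex_realP[x ->] := dr 0 i.
Qed.

Lemma char_poly_eigenvalues (R : rcfType) (n : nat) (A : 'M[R]_n) :
  A^T = A -> char_poly A = \prod_(x <- eigenvalues A) ('X - x%:P).
Proof.
move=> /char_poly_split[d pE].
pose s := [seq d i | i <- enum 'I_n].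
have {}pE : char_poly A = \prod_(x <- s) ('X - x%:P).
  by rewrite pE big_map big_enum.
rewrite [LHS]pE; apply/perm_big/allP => x _ /=; apply/eqP.
rewrite -mu_prod_XsubC -pE /eigenvalues count_flatten sumnE !big_map.
have p0 : char_poly A != 0 by rewrite monic_neq0 ?char_poly_monic.
have u : uniq (rootsR (char_poly A)) by apply: uniq_roots.
rewrite -[LHS](_ : \sum_(y <- rootsR (char_poly A) | y == x) mup y (char_poly A) = _)%N.
  rewrite big_mkcond; apply: eq_bigr => y _.
  by rewrite count_nseq /=; case: eqVneq; rewrite ?mul1n.
rewrite -big_filter.
have [xr|xr] := boolP (x \in rootsR (char_poly A)).
  by rewrite filter_pred1_uniq // big_seq1.
rewrite (_ : [seq _ <- _ | _] = [::]) ?big_nil.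
  rewrite mupNroot //; apply: contra xr => xr.
  by rewrite -(roots_on_rootsR p0) xr in_itv.
by apply/eqP; rewrite -size_eq0 size_filter; apply/eqP/count_memPn.
Qed.

Definition singular_values (R : rcfType) (n m : nat) (B : 'M[R]_(n, m)) :
    seq R :=
  [seq Num.sqrt x | x <- eigenvalues (B *m B^T)].

Definition randic_incidence_energy (R : rcfType) (T : finType)
    (G : sgraph T) : R :=
  \sum_(s <- singular_values (randic_incidence R G)) s.

(* Main.v *)
(** Let [B] be the incidence matrix. The Gram matrix [B *m B^T] is [1 + R] with
    [R x y = 1 / sqrt (d x * d y)] on adjacent pairs. The vector [sqrt (d x)] and its
    signed version along the bipartition are eigenvectors for [2] and [0]; the
    remaining [n - 2] eigenvalues [l] are nonnegative with sum [n - 2], and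
    [2 * (n - 2 - \sum sqrt l) = \sum (sqrt l - 1)^2 >= 0], with equality iff
    [\sum (l - 1)^2 = 0]. By the trace of the squared Gram matrix, the latter sum
    is [S - 2], where [S] is the sum of [1 / (d x * d y)] over ordered adjacent
    pairs. Finally [S - 2] is the weighted sum of squares of the differences
    between [1 / (d x * d y)] on adjacent pairs and [1 / m] on pairs separated by
    the bipartition ([m] the number of edges), so that it vanishes only when
    every separated pair is adjacent. *)
Require Import Defs.
From mathcomp Require Import all_boot all_order all_algebra.
From mathcomp Require Import complex ring lra.
Import Order.TTheory GRing.Theory Num.Theory.
Local Open Scope ring_scope.

(** * Spectra of symmetric matrices and a square root inequality *)

Lemma char_poly_conj (F : fieldType) (n : nat) (P A : 'M[F]_n) :
  P \in unitmx -> char_poly (invmx P *m A *m P) = char_poly A.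
Proof.
move=> Pu; rewrite /char_poly; pose Q := map_mx polyC P.
have QV : map_mx polyC (invmx P) *m Q = 1%:M.
  by rewrite -map_mxM mulVmx // map_mx1.
have -> : char_poly_mx (invmx P *m A *m P) =
    map_mx polyC (invmx P) *m char_poly_mx A *m Q.
  rewrite /char_poly_mx !map_mxM mulmxBr mulmxBl; congr (_ - _).
  by rewrite scalar_mxC -mulmxA QV mulmx1.
by rewrite !det_mulmx mulrAC -det_mulmx QV det1 mul1r.
Qed.

(** Over [R[i]] the spectral theorem diagonalizes [A], so both traces can be read off the diagonal
    [D]; injectivity of [f] brings the identities back to [R]. *)
Lemma sum_eigenvalues (R : rcfType) (n : nat) (A : 'M[R]_n) : A^T = A ->
  \sum_(x <- eigenvalues A) x = \tr A /\
  \sum_(x <- eigenvalues A) x ^+ 2 = \tr (A *m A).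
Proof.
move=> sA; pose f := real_complex R.
have Ah : map_mx f A \is symmetricmx.
  by rewrite qualifE /= expr0 scale1r map_mx_id // map_trmx sA.
have Ar : map_mx f A \is a realmx.
  by apply/mxOverP=> i j; rewrite mxE; apply/complex_realP; exists (A i j).
have /orthomx_spectralP := symmetric_normalmx Ah Ar.
set P := spectralmx _; set D := spectral_diag _ => AE.
have Pu : P \in unitmx by apply: spectral_unit.
(* Both lists are the roots, with multiplicity, of the same split characteristic polynomial. *)
have pE : perm_eq [seq f x | x <- eigenvalues A] [seq D 0 i | i <- enum 'I_n].
  apply: prod_XsubC_eq; rewrite big_map [RHS]big_map big_enum /=.
  transitivity (char_poly (map_mx f A)).
    rewrite -map_char_poly char_poly_eigenvalues // rmorph_prod.
    by apply: eq_bigr => x _; rewrite rmorphB /= map_polyX map_polyC.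
  rewrite AE char_poly_conj // char_poly_trig ?diag_mx_is_trig //.
  by apply: eq_bigr => i _; rewrite mxE eqxx mulr1n.
split; apply: (fmorph_inj f).
  rewrite rmorph_sum -(big_map f predT id) (perm_big _ pE) big_map big_enum /=.
  by rewrite -trace_map_mx AE mxtrace_mulC mulKVmx // mxtrace_diag.
rewrite rmorph_sum /=; under eq_bigr do rewrite rmorphXn.
rewrite -(big_map f predT (fun x => x ^+ 2)) (perm_big _ pE) big_map big_enum /=.
rewrite -trace_map_mx map_mxM AE -!mulmxA mulKVmx // mxtrace_mulC -!mulmxA.
rewrite mulmxV // mulmx1 mulmx_diag mxtrace_diag.
by apply: eq_bigr => i _; rewrite mxE.
Qed.

Lemma size_eigenvalues (R : rcfType) (n : nat) (A : 'M[R]_n) :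
  A^T = A -> size (eigenvalues A) = n.
Proof.
move=> /char_poly_eigenvalues /(congr1 (fun p : {poly R} => size p)).
by rewrite size_char_poly size_prod_XsubC => -[].
Qed.

Lemma mem_eigenvalues (R : rcfType) (n : nat) (A : 'M[R]_n) (a : R) :
  A^T = A -> (a \in eigenvalues A) = eigenvalue A a.
Proof.
by move=> sA; rewrite eigenvalue_root_char char_poly_eigenvalues // root_prod_XsubC.
Qed.

(** For a row eigenvector [v], the squared norm of [v *m B] is [a] times that of [v], which is
    positive. *)
Lemma gram_eigenvalue_ge0 (R : rcfType) (n m : nat) (B : 'M[R]_(n, m)) (a : R) :
  eigenvalue (B *m B^T) a -> 0 <= a.
Proof.
move=> /eigenvalueP[v vE v0].
have sqE k (u : 'rV[R]_k) : (u *m u^T) 0 0 = \sum_i u 0 i ^+ 2.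
  by rewrite mxE; apply: eq_bigr => i _; rewrite mxE.
have sq0 k (u : 'rV[R]_k) : 0 <= (u *m u^T) 0 0.
  by rewrite sqE; apply: sumr_ge0 => i _; apply: sqr_ge0.
have : a * (v *m v^T) 0 0 = ((v *m B) *m (v *m B)^T) 0 0.
  by rewrite trmx_mul mulmxA -[v *m B *m _]mulmxA vE -scalemxAl [RHS]mxE.
move=> aE; rewrite -(@pmulr_lge0 _ ((v *m v^T) 0 0)) ?aE //.
rewrite lt_neqAle sq0 andbT eq_sym; apply: contra v0 => /eqP.
rewrite sqE => /psumr_eq0P v0; apply/eqP/rowP => i; rewrite mxE.
by apply/eqP; rewrite -sqrf_eq0 v0 // => j _; apply: sqr_ge0.
Qed.

(** As the entries have mean 1, the deficit in the bound is half of [\sum (sqrt x - 1)^2]. This sum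
    and [\sum (x - 1)^2] both vanish exactly when all entries are 1. *)
Lemma sum_sqrt_le (R : rcfType) (l : seq R) :
  (forall x, x \in l -> 0 <= x) -> \sum_(x <- l) x = (size l)%:R ->
  \sum_(x <- l) Num.sqrt x <= (size l)%:R /\
  (\sum_(x <- l) Num.sqrt x = (size l)%:R <-> \sum_(x <- l) (x - 1) ^+ 2 = 0).
Proof.
move=> l0 lE.
have cE : \sum_(x <- l) (1 : R) = (size l)%:R.
  by rewrite big_const_seq count_predT iter_addr_0.
have sE : \sum_(x <- l) (Num.sqrt x - 1) ^+ 2 =
    2 * ((size l)%:R - \sum_(x <- l) Num.sqrt x).
  transitivity (\sum_(x <- l) (x - 2 * Num.sqrt x + 1)).
    rewrite !big_seq; apply: eq_bigr => x /l0 /sqr_sqrtr xE.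
    by rewrite sqrrB1 xE mulr_natl.
  rewrite big_split sumrB -mulr_sumr lE cE /=; ring.
have s0 : 0 <= \sum_(x <- l) (Num.sqrt x - 1) ^+ 2.
  by apply: sumr_ge0 => x _; apply: sqr_ge0.
split; first by move: s0; rewrite sE; lra.
have ge0 (h : R -> R) (x : R) : true -> 0 <= h x ^+ 2 by rewrite sqr_ge0.
split=> [e|/eqP].
  have /eqP : \sum_(x <- l) (Num.sqrt x - 1) ^+ 2 = 0 by rewrite sE e subrr mulr0.
  rewrite psumr_eq0; last exact: ge0.
  move=> /allP h; rewrite big_seq big1 // => x xl.
  move: (h x xl); rewrite /= sqrf_eq0 subr_eq0 => /eqP x1.
  by rewrite -(sqr_sqrtr (l0 x xl)) x1 expr1n subrr expr0n.
rewrite psumr_eq0; last exact: ge0.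
move=> /allP h; rewrite -cE big_seq [RHS]big_seq.
apply: eq_bigr => x xl; move: (h x xl).
by rewrite /= sqrf_eq0 subr_eq0 => /eqP ->; rewrite sqrtr1.
Qed.

(** * Counting edges through given vertices *)

Lemma mem_edges (T : finType) (G : sgraph T) (x y : T) :
  ([set x; y] \in edges G) = G x y.
Proof.
apply/imsetP/idP => [[[a b]]|xy]; last by exists (x, y); rewrite ?inE.
rewrite inE /= => ab e.
have xe : x \in [set a; b] by rewrite -e set21.
have ye : y \in [set a; b] by rewrite -e set22.
have ae : a \in [set x; y] by rewrite e set21.
have be : b \in [set x; y] by rewrite e set22.
move: xe ye ae be; rewrite !inE => /orP[]/eqP-> /orP[]/eqP->.
- by rewrite !orbb => _ /eqP ba; rewrite ba adj_irr in ab.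
- by [].
- by rewrite adj_sym.
by rewrite !orbb => /eqP ba; rewrite ba adj_irr in ab.
Qed.

Lemma edges_at (T : finType) (G : sgraph T) (x : T) :
  [set e in edges G | x \in e] = [set [set x; z] | z in [set z | G x z]].
Proof.
apply/setP => e; rewrite inE; apply/andP/imsetP => [[/imsetP[[a b]]]|].
  rewrite inE /= => ab ->.
  rewrite !inE => /orP[]/eqP ?; subst x; first by exists b; rewrite ?inE.
  by exists a; [rewrite inE adj_sym | rewrite setUC].
by move=> [z]; rewrite inE => xz ->; rewrite mem_edges set21.
Qed.

(** The map from a neighbour [z] to [[set x; z]] is injective because [x] is not its own
    neighbour. *)
Lemma card_edges_at (T : finType) (G : sgraph T) (x : T) :
  #|[set e in edges G | x \in e]| = deg G x.
Proof.
rewrite edges_at card_in_imset // => y z; rewrite !inE => xy xz e.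
have : y \in [set x; z] by rewrite -e set22.
by rewrite !inE => /orP[]/eqP // yx; move: xy; rewrite yx adj_irr.
Qed.

Lemma card_edges_between (T : finType) (G : sgraph T) (x y : T) : x != y ->
  #|[set e in edges G | (x \in e) && (y \in e)]| = G x y.
Proof.
move=> xy.
have -> : [set e in edges G | (x \in e) && (y \in e)] =
    if G x y then [set [set x; y]] else set0.
  apply/setP => e; rewrite inE; apply/andP/idP => [[ee /andP[xe ye]]|].
    have : e \in [set [set x; z] | z in [set z | G x z]].
      by rewrite -edges_at inE ee.
    move=> /imsetP[z]; rewrite inE => xz eE; move: ye; rewrite eE !inE eq_sym.
    by rewrite (negPf xy) /= => /eqP ->; rewrite xz inE.
  case: ifP => [Gxy|]; rewrite inE // => /eqP ->.
  by rewrite mem_edges Gxy set21 set22.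
by case: ifP => _; rewrite ?cards1 ?cards0.
Qed.

(** * The Gram matrix of the Randić incidence matrix *)

Section Gram.
Variables (R : rcfType) (T : finType) (G : sgraph T).
Hypothesis G0 : no_isolated G.
Local Notation d x := ((deg G x)%:R : R).
Local Notation w x y := ((G x y)%:R : R).
Local Notation M := (randic_incidence R G *m (randic_incidence R G)^T).

Lemma deg_gt0 x : 0 < d x. Proof. by rewrite ltr0n. Qed.

Lemma sum_adj x : \sum_y w x y = d x.
Proof.
rewrite /deg -sum1_card natr_sum [RHS]big_mkcond; apply: eq_bigr => y _.
by rewrite inE; case: ifP.
Qed.

(** The entry is the number of edges containing both vertices, divided by the two square roots:
    [d x / d x] on the diagonal, and at most one edge off it. *)
Lemma randic_gramE i j : M i j = (i == j)%:R +
  w (enum_val i) (enum_val j) /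
    (Num.sqrt (d (enum_val i)) * Num.sqrt (d (enum_val j))).
Proof.
set x := enum_val i; set y := enum_val j.
have -> : (i == j) = (x == y) by rewrite (inj_eq enum_val_inj).
transitivity (\sum_(e in edges G)
   ((x \in e) && (y \in e))%:R / (Num.sqrt (d x) * Num.sqrt (d y))).
  rewrite mxE [RHS]big_enum_val; apply: eq_bigr => e _; rewrite !mxE -/x -/y.
  by case: (x \in _); case: (y \in _); rewrite /= ?mulr0 ?mul0r // mul1r invfM mulrC.
rewrite -mulr_suml; have -> : \sum_(e in edges G)
   ((x \in e) && (y \in e))%:R =
     (#|[set e in edges G | (x \in e) && (y \in e)]|)%:R :> R.
  rewrite -sum1_card natr_sum big_mkcond [RHS]big_mkcond; apply: eq_bigr => e _.
  by rewrite inE; case: ifP => // _; case: (_ && _).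
case: eqVneq => [<-|xy]; last by rewrite card_edges_between // add0r.
rewrite (_ : [set _ in _ | _] = [set e in edges G | x \in e]); last first.
  by apply/setP => e; rewrite !inE andbb.
rewrite card_edges_at adj_irr mul0r addr0 -expr2 sqr_sqrtr ?ltW ?deg_gt0 //.
by rewrite mulfV ?gt_eqF ?deg_gt0.
Qed.


Lemma big_ord_enum_val (V : nmodType) (F : T -> V) :
  \sum_(i < #|T|) F (enum_val i) = \sum_x F x.
Proof. by rewrite -big_enum_val. Qed.

Lemma randic_gram_sym : M^T = M.
Proof. by rewrite trmx_mul trmxK. Qed.

Lemma randic_gram_trace : \tr M = #|T|%:R.
Proof.
rewrite /mxtrace; under eq_bigr do rewrite randic_gramE eqxx adj_irr mul0r addr0.
by rewrite sumr_const card_ord.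
Qed.

(** The trace sums the squares of the entries. The diagonal ones are 1, and off the diagonal the
    adjacency value is 0 or 1, hence its own square. *)
Lemma randic_gram_trace_sqr :
  \tr (M *m M) = #|T|%:R + \sum_x \sum_y w x y / (d x * d y).
Proof.
rewrite -randic_gram_trace /mxtrace -big_ord_enum_val -big_split.
apply: eq_bigr => i _ /=; rewrite mxE -big_ord_enum_val.
rewrite (bigD1 i) //= [in RHS](bigD1 i) //= adj_irr mul0r add0r.
congr (_ + _); first by rewrite !randic_gramE eqxx adj_irr mul0r addr0 mulr1.
apply: eq_bigr => j ji; rewrite !randic_gramE [i == j]eq_sym (negPf ji) !add0r.
rewrite (adj_sym G (enum_val j)) mulrACA -(natrM _ (G _ _)) mulnb andbb -invfM; congr (_ / _).
by rewrite mulrACA [X in _ * X]mulrC -mulrACA -!expr2 !sqr_sqrtr ?ltW ?deg_gt0.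
Qed.

(** The eigenvector is [c x * sqrt (d x)]: each of the [d y] neighbours of [y] contributes
    [k * c y / sqrt (d y)]. The vertex [x0] ensures that the vector is nonzero. *)
Lemma randic_gram_eigenvalue (c : T -> R) (k : R) (x0 : T) : c x0 != 0 ->
  (forall x y, G x y -> c x = k * c y) -> eigenvalue M (1 + k).
Proof.
move=> c0 ck; pose r x := Num.sqrt (d x).
have r0 x : r x != 0 by rewrite gt_eqF // sqrtr_gt0 deg_gt0.
apply/eigenvalueP; exists (\row_j (c (enum_val j) * r (enum_val j))); last first.
  apply: contra_neq c0 => /rowP/(_ (enum_rank x0)); rewrite !mxE enum_rankK.
  by move/eqP; rewrite mulf_eq0 (negPf (r0 _)) orbF => /eqP.
apply/rowP => j; rewrite !mxE; set y := enum_val j.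
transitivity (\sum_x (c x * r x * (x == y)%:R + k * c y * w y x / r y)).
  rewrite -big_ord_enum_val; apply: eq_bigr => i _.
  rewrite randic_gramE mxE -/y -(inj_eq enum_val_inj) -/y mulrDr.
  set x := enum_val i; congr (_ + _); rewrite (adj_sym G y).
  rewrite -/(r x) -/(r y) invfM; case: (boolP (G x y)) => [/ck <-|_]; last first.
    by rewrite !(mul0r, mulr0).
  by rewrite mulr1 mul1r mulrA -(mulrA (c x)) divff // mulr1.
rewrite big_split /= -mulr_suml -mulr_sumr sum_adj (bigD1 y) //= eqxx mulr1.
rewrite big1 ?addr0 => [|x /negPf ->]; last by rewrite mulr0.
have -> : d y = r y ^+ 2 by rewrite sqr_sqrtr // ltW ?deg_gt0.
by field.
Qed.

(** * Degree sums across a bipartition and the energy bound *)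

Section Bipartition.
Variable A : {set T}.
Hypothesis GA : forall x y, G x y -> (x \in A) != (y \in A).
Hypothesis T0 : (0 < #|T|)%N.
Local Notation a x := ((x \in A)%:R : R).
Local Notation m := (\sum_x a x * d x).

(** Each edge has exactly one end in [A], so [m] counts the edges. *)
Lemma sum_deg_bipartite : \sum_x d x = 2 * m.
Proof.
have mE : m = \sum_x \sum_y a x * w x y.
  by apply: eq_bigr => x _; rewrite -sum_adj mulr_sumr.
have -> : 2 * m = \sum_x \sum_y (a x * w x y + a y * w x y).
  under [RHS]eq_bigr => x _ do rewrite big_split /=.
  rewrite big_split -mE /=.
  rewrite [X in _ = _ + X]exchange_big /= mulr2n mulrDl mul1r; congr (_ + _).
  by rewrite mE; apply: eq_bigr => x _; apply: eq_bigr => y _; rewrite (adj_sym G).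
apply: eq_bigr => x _; rewrite -sum_adj; apply: eq_bigr => y _.
case: (boolP (G x y)) => [/GA|_]; last by rewrite !mulr0 addr0.
by case: (x \in A); case: (y \in A); rewrite //= ?mul1r ?mul0r ?addr0 ?add0r.
Qed.

Lemma bipartite_part_deg_gt0 : 0 < m.
Proof.
have : 0 < \sum_x d x.
  case/card_gt0P: T0 => x0 _; rewrite (bigD1 x0) //= ltr_wpDr ?deg_gt0 //.
  by apply: sumr_ge0 => x _; apply: ler0n.
by rewrite sum_deg_bipartite pmulr_rgt0 ?ltr0n.
Qed.

(** Adjacent pairs are separated, so the cross terms sum to [- (2 / m) * (2 * m) = -4]; the squares
    of [1 / m] contribute [2 * m^2 / m^2 = 2]. *)
Lemma sum_randic_sqr :
  \sum_x \sum_y w x y / (d x * d y) - 2 =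
  \sum_x \sum_y d x * d y *
    (w x y / (d x * d y) - ((x \in A) != (y \in A))%:R / m) ^+ 2.
Proof.
have m0 := bipartite_part_deg_gt0; set k := m in m0 *.
have sE : \sum_x d x = 2 * k by apply: sum_deg_bipartite.
(* The indicator of separated pairs is written [a x + a y - 2 * a x * a y], so that the double sums
   factor. *)
transitivity (\sum_x \sum_y (w x y / (d x * d y) - 2 / k * w x y +
   (k ^- 2 * (a x * d x) * d y + k ^- 2 * d x * (a y * d y)
     - 2 * k ^- 2 * (a x * d x) * (a y * d y)))).
  under [RHS]eq_bigr => x _.
    rewrite !(sumrB, big_split) /= -!mulr_sumr sum_adj sE -/k.
    over.
  rewrite !(sumrB, big_split) /= -!mulr_sumr -!mulr_suml -!mulr_sumr sE -/k.
  by field; rewrite gt_eqF.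
apply: eq_bigr => x _; apply: eq_bigr => y _.
have dx := deg_gt0 x; have dy := deg_gt0 y.
have : w x y ^+ 2 = w x y by case: (G x y); rewrite ?expr1n ?expr0n.
move: (@GA x y).
by case: (G x y); case: (x \in A); case: (y \in A) => //= h _;
  try (by have := h isT); field; rewrite ?gt_eqF.
Qed.

(** If the weighted squares sum to 0, then each difference is 0, and adjacency and separation must
    agree since [1 / (d x * d y)] and [1 / m] are nonzero. In the complete case the differences
    vanish because [d x * d y = m] on separated pairs. *)
Lemma complete_sum_randic_sqr :
  \sum_x \sum_y w x y / (d x * d y) = 2 <->
  (forall x y, G x y = ((x \in A) != (y \in A))).
Proof.
have m0 := bipartite_part_deg_gt0.
have t0 x y : 0 <= d x * d y *
    (w x y / (d x * d y) - ((x \in A) != (y \in A))%:R / m) ^+ 2.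
  by rewrite mulr_ge0 ?sqr_ge0 // mulr_ge0 ?ler0n.
split=> [/eqP|GE].
  rewrite -subr_eq0 sum_randic_sqr => /eqP S0 x y.
  have := psumr_eq0P (fun x _ => sumr_ge0 _ (fun y _ => t0 x y)) S0.
  move=> /(_ x isT)/(psumr_eq0P (fun y _ => t0 x y))/(_ y isT)/eqP.
  rewrite mulf_eq0 gt_eqF ?mulr_gt0 ?deg_gt0 //= sqrf_eq0 subr_eq0.
  have dxy : (d x * d y)^-1 != 0 by rewrite invr_eq0 gt_eqF ?mulr_gt0 ?deg_gt0.
  case: (G x y); case: (_ != _) => //; rewrite ?mul0r ?mul1r ?(negPf dxy) //.
  by rewrite eq_sym invr_eq0 gt_eqF.
apply/eqP; rewrite -subr_eq0 sum_randic_sqr; apply/eqP.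
(* These are the sizes of the two sides; each vertex has the opposite side as its neighbourhood. *)
pose p : R := \sum_x a x; pose q : R := \sum_x (1 - a x).
have dE x : d x = if x \in A then q else p.
  rewrite -sum_adj; case: ifP => xA; apply: eq_bigr => y _; rewrite GE xA.
    by case: (y \in A); rewrite ?subrr ?subr0.
  by case: (y \in A).
have mE : m = p * q.
  by rewrite mulr_suml; apply: eq_bigr => x _; rewrite dE; case: ifP; rewrite ?mul0r.
apply: big1 => x _; apply: big1 => y _; rewrite GE mE.
suff -> : ((x \in A) != (y \in A))%:R / (d x * d y) =
    ((x \in A) != (y \in A))%:R / (p * q) by rewrite subrr expr0n mulr0.
rewrite !dE; case: (x \in A); case: (y \in A); rewrite ?mul0r //.
by rewrite (mulrC q).
Qed.

Lemma randic_energy_bipartite :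
  randic_incidence_energy R G <= #|T|%:R - 2 + Num.sqrt 2 /\
  (randic_incidence_energy R G = #|T|%:R - 2 + Num.sqrt 2 <->
   \sum_x \sum_y w x y / (d x * d y) = 2).
Proof.
have [tr1 tr2] := sum_eigenvalues R _ M randic_gram_sym.
have szE := size_eigenvalues R _ M randic_gram_sym.
rewrite randic_gram_trace in tr1; rewrite randic_gram_trace_sqr in tr2.
have [x0 _] := card_gt0P T0.
(* Constant [c] with [k = 1]. *)
have E2 : 2 \in eigenvalues M.
  rewrite mem_eigenvalues ?randic_gram_sym // (_ : 2 = 1 + 1) //.
  by apply: (randic_gram_eigenvalue (fun=> 1) _ x0); rewrite ?oner_eq0 // mul1r.
(* The sign along the bipartition flips across every edge, so [k = -1]. *)
have E0 : 0 \in eigenvalues M.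
  rewrite mem_eigenvalues ?randic_gram_sym // -(subrr 1).
  apply: (randic_gram_eigenvalue (fun x => (-1) ^+ (x \in A)) _ x0).
    by rewrite signr_eq0.
  by move=> x y /GA; case: (x \in A); case: (y \in A); rewrite //= ?mulN1r ?opprK.
(* Since 2 and 0 differ, 0 is still present after one copy of 2 is removed. *)
have [l El] : exists l, perm_eq (eigenvalues M) [:: 2, 0 & l].
  exists (rem 0 (rem 2 (eigenvalues M))).
  apply: perm_trans (perm_to_rem E2) _; rewrite perm_cons perm_to_rem //.
  move: E0; rewrite (perm_mem (perm_to_rem E2)) inE.
  by rewrite eq_sym pnatr_eq0.
have l0 x : x \in l -> 0 <= x.
  move=> xl; apply: (@gram_eigenvalue_ge0 R _ _ (randic_incidence R G)).
  by rewrite -mem_eigenvalues ?randic_gram_sym // (perm_mem El) !inE xl !orbT.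
rewrite /randic_incidence_energy big_map (perm_big _ El) 2!big_cons /= sqrtr0 add0r.
move: tr1 tr2; rewrite !(perm_big _ El) /= !big_cons.
have -> : #|T|%:R = (size l)%:R + 2 :> R.
  by rewrite -natrD -szE (perm_size El) addn2.
move=> tr1 tr2; have lE : \sum_(x <- l) x = (size l)%:R by move: tr1; lra.
have [le eq] := sum_sqrt_le R l l0 lE.
(* The removed eigenvalues account for 4 in the trace of the square, leaving
   [\sum x^2 = size l + S - 2]. *)
have sE : \sum_(x <- l) (x - 1) ^+ 2 = \sum_x \sum_y w x y / (d x * d y) - 2.
  have -> : \sum_(x <- l) (x - 1) ^+ 2 = \sum_(x <- l) x ^+ 2
      - \sum_(x <- l) x *+ 2 + \sum_(x <- l) 1.
    by rewrite -sumrB -big_split; apply: eq_bigr => x _ /=; rewrite sqrrB1.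
  rewrite sumrMnl lE big_const_seq count_predT iter_addr_0; move: tr2; lra.
split; first by move: le; lra.
rewrite sE in eq; split=> [e|e].
  by apply/eqP; rewrite -subr_eq0; apply/eqP/eq; move: e; lra.
by have := eq.2; rewrite e subrr => /(_ erefl) ->; lra.
Qed.

End Bipartition.
End Gram.

Theorem theorem4p1 (R : rcfType) (T : finType) (G : sgraph T) :
  (0 < #|T|)%N -> bipartite G -> no_isolated G ->
  randic_incidence_energy R G <= #|T|%:R - 2 + Num.sqrt 2 /\
  (randic_incidence_energy R G = #|T|%:R - 2 + Num.sqrt 2 <->
   complete_bipartite G).
Proof.
move=> T0 [A GA] G0.
have [le eq] := randic_energy_bipartite R T G G0 A GA T0.
split=> //; apply: (iff_trans eq); split=> [S2|[B [_ _ GB]]]; last first.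
  (* The part [B] may differ from [A], but the sum of [1 / (d x * d y)] does not depend on the
     bipartition, so the criterion applies with [B]. *)
  by apply/(complete_sum_randic_sqr R T G G0 B _ T0) => // x y; rewrite GB.
have GE := (complete_sum_randic_sqr R T G G0 A GA T0).1 S2.
(* The two ends of one edge show that both sides are nonempty. *)
have [x _] := card_gt0P T0; have [y] := card_gt0P (G0 x); rewrite inE => /GA xy.
exists A; split=> //; apply/set0Pn; [exists (if x \in A then x else y)|
  exists (if x \in A then y else x)]; move: xy; rewrite ?inE;
  by case: ifP => // xA; case: (boolP (y \in A)); rewrite ?xA.
Qed.
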